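(* Let $u$ be an even permutation in $S_n$. Then $\tilde G_3(u)=\{h\in S_n : (uh)^3=h^3\}$ is not empty in each of the following cases: (1) $u$ is a single cycle of odd length $k=2c+1$, where $c\in\mathbb{N}$; (2) $u$ is the product of a transposition and a disjoint cycle of even length; (3) $u$ is the product of a 4-cycle and a disjoint cycle of even length at least 4. Specifically, in each case there exists $h\in\tilde G_3(u)$ such that $h^3=\mathrm{id}$. *)

(* Defs.v *)
From mathcomp Require Import all_boot all_fingroup.

Set Implicit Arguments.
Unset Strict Implicit.
Unset Printing Implicit Defensive.

(* [next c] sends each entry of the duplicate-free sequence c to its cyclic
   successor and fixes every point outside c. The condition [0 < k] rules out
   the empty sequence; a cycle of length 1 is the identity. *)
Definition is_cycle (T : finType) (k : nat) (s : {perm T}) : Prop :=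
  0 < k /\ exists c : seq T, [/\ uniq c, size c = k & s =1 next c].

Definition is_transposition (T : finType) (s : {perm T}) : Prop :=
  exists x y : T, x != y /\ s = tperm x y.

Definition perm_support (T : finType) (s : {perm T}) : {set T} :=
  [set x | s x != x].

Definition disjoint_perms (T : finType) (s t : {perm T}) : bool :=
  [disjoint perm_support s & perm_support t].

(* In {perm T} the product [u * h] applies u first. The opposite convention
   yields the same set: h * u is the conjugate of u * h by h^-1, and h commutes
   with h ^+ 3, so (h * u) ^+ 3 = h ^+ 3 iff (u * h) ^+ 3 = h ^+ 3. *)
Definition G3 (n : nat) (u : 'S_n) : {set 'S_n} :=
  [set h : 'S_n | ((u * h) ^+ 3 == h ^+ 3)%g].

(* Main.v *)
Require Import Defs.
From mathcomp Require Import all_boot all_fingroup.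

(** If [u = A * B] with [A ^+ 3 = B ^+ 3 = 1], then [h = B^-1] satisfies
    [h ^+ 3 = 1] and [(u * h) ^+ 3 = A ^+ 3 = 1].  So it suffices to write [u]
    as a product of two permutations of order dividing 3.

    Such factorizations are glued from small ones.  If [u = A * B] and
    [u' = A' * B'], and if [A'] commutes with [A] and [B] while [B'] commutes
    with [B], then [u * u' = (A * A') * (B * B')] and the two factors still have
    trivial cube ([factor_mul]).  Only [A] and [B'] may overlap, and this is
    enough to hang 3-cycles on one another in a chain, alternately on either
    factor.

    An odd cycle is such a chain:
    [(p x y s) = (p x y) * (p s)], where the shorter cycle [(p s)] is factored
    so that its left factor fixes [p] ([odd_cycle_factor]).

    For two disjoint even cycles, the chain starts from
    [(a b)(d e) = (d e b) * (b d a)] on four points.  The left factor fixes [a]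
    and the right one fixes [e]; since [a] and [e] lie in different
    transpositions, each of the two can be lengthened by an odd cycle through
    its distinguished point, which gives every pair of even lengths
    ([even_cycles_factor]).  A transposition is a cycle of length 2, so this
    settles the last two cases together. *)

Set Implicit Arguments.
Unset Strict Implicit.
Unset Printing Implicit Defensive.

Import GroupScope.

Section CubeFactorizations.

Variable T : finType.
Implicit Types (x y p i : T) (s P Q : seq T) (u v A B : {perm T}).

(** * Cycles as products of transpositions *)

(** The cycle through [x :: s].  With products read from left to right, sharing
    the point [x] between all transpositions turns concatenation of lists into
    multiplication of cycles. *)
Definition cyc x s : {perm T} := \prod_(y <- s) tperm x y.

Lemma cyc_cons x y s : cyc x (y :: s) = tperm x y * cyc x s.
Proof. exact: big_cons. Qed.

Lemma cyc_cat x s1 s2 : cyc x (s1 ++ s2) = cyc x s1 * cyc x s2.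
Proof. exact: big_cat. Qed.

Lemma cyc1 x y : cyc x [:: y] = tperm x y.
Proof. exact: big_seq1. Qed.

Lemma cyc_on x s : perm_on [set i in x :: s] (cyc x s).
Proof.
rewrite /cyc big_seq.
apply: (big_ind (fun u => perm_on [set i in x :: s] u)).
- exact: perm_on1.
- exact: perm_onM.
move=> y ys; apply: subset_trans (tperm_on x y) _.
by apply/subsetP => i; rewrite !inE => /orP[] /eqP->; rewrite ?eqxx ?ys ?orbT.
Qed.

Lemma cycE x s : uniq (x :: s) -> cyc x s =1 next (x :: s).
Proof.
elim: s => [_ i | y s IHs].
  by rewrite /cyc big_nil perm1 /=; case: eqP.
rewrite /= inE negb_or -andbA => /and4P[xy xs ys us] i.
have {}IHs : cyc x s =1 next (x :: s) by apply: IHs; rewrite /= xs us.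
rewrite cyc_cons permM; case: tpermP => [-> | -> | /eqP ix /eqP iy].
- rewrite (out_perm (cyc_on x s)) /= ?eqxx //.
  by rewrite !inE negb_or eq_sym xy ys.
- rewrite IHs /= (eq_sym y x) (negPf xy).
  by case: s {xs ys us IHs} => [|z s] /=; rewrite !eqxx.
- rewrite IHs /= (negPf ix).
  by case: s {xs ys us IHs} => [|z s] //=; rewrite (negPf ix) (negPf iy).
Qed.

Lemma cyc_inv x s : (cyc x s)^-1 = cyc x (rev s).
Proof.
rewrite /cyc -[in LHS](revK s) -prodgV.
by apply: eq_bigr => y _; rewrite tpermV.
Qed.

(** Conjugating by [tperm x p] renames the shared point of the transpositions
    from [x] to [p]. *)
Lemma cyc_rot x p s : uniq (x :: rcons s p) -> cyc x (rcons s p) = cyc p (x :: s).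
Proof.
rewrite /= rcons_uniq mem_rcons inE negb_or => /and3P[/andP[_ xs] ps _].
rewrite -cats1 cyc_cat cyc1 cyc_cons (tpermC p x) conjgC; congr (_ * _).
rewrite /cyc (big_morph (fun u => u ^ _) (fun u v => conjMg u v (tperm x p)) (conj1g _)).
apply: eq_big_seq => y ys; rewrite tpermJ tpermL tpermD //.
  by apply: contraNneq xs => ->.
by apply: contraNneq ps => ->.
Qed.

(** With [w] the third transposition on the three points,
    [(t1 t2) ^ 3 = (t1 t2 t1) (t2 t1 t2) = w * w = 1]. *)
Lemma cyc3_expg3 x y p : uniq [:: p; x; y] -> cyc p [:: x; y] ^+ 3 = 1.
Proof.
rewrite /= !inE negb_or !andbT => /andP[/andP[px py] xy].
rewrite cyc_cons cyc1 !expgS expg0 mulg1.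
have E1 : tperm p x * tperm p y * tperm p x = tperm x y.
  by rewrite -{1}(tpermV p x) -mulgA -/(conjg _ _) tpermJ tpermL tpermD.
have E2 : tperm p y * tperm p x * tperm p y = tperm x y.
  rewrite -{1}(tpermV p y) -mulgA -/(conjg _ _) tpermJ tpermL tpermD 1?tpermC //.
  by rewrite eq_sym.
by rewrite !mulgA E1 -2!(mulgA (tperm x y)) E2 tperm2.
Qed.

(** * Products of two permutations of order dividing 3 *)

(** The sequences bound the supports of the two factors: that a factor fixes a
    given point of the support of [u] is what allows a further factorization to
    be attached there. *)
Definition factor P Q u :=
  exists A B, [/\ u = A * B, A ^+ 3 = 1, B ^+ 3 = 1,
                  perm_on [set i in P] A & perm_on [set i in Q] B].

Lemma factor_sub P P' Q Q' u :
  {subset P <= P'} -> {subset Q <= Q'} -> factor P Q u -> factor P' Q' u.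
Proof.
move=> sP sQ [A [B [-> A3 B3 PA QB]]]; exists A, B; split=> //.
  by apply: subset_trans PA _; apply/subsetP => i; rewrite !inE => /sP.
by apply: subset_trans QB _; apply/subsetP => i; rewrite !inE => /sQ.
Qed.

Lemma factor_inv P Q u : factor P Q u -> factor Q P u^-1.
Proof.
move=> [A [B [-> A3 B3 PA QB]]]; exists B^-1, A^-1.
by rewrite invMg !expgVn A3 B3 invg1; split=> //; apply: perm_onV.
Qed.

Lemma disjoint_perm_onC P Q A B :
  [disjoint P & Q] -> perm_on [set i in P] A -> perm_on [set i in Q] B ->
  commute A B.
Proof.
move=> /pred0P dPQ PA QB; apply: perm_onC PA QB _.
by apply/pred0P => i; rewrite /= !inE; apply: dPQ.
Qed.

Lemma perm_on_catM P Q A B :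
  perm_on [set i in P] A -> perm_on [set i in Q] B ->
  perm_on [set i in P ++ Q] (A * B).
Proof.
move=> PA QB; apply: perm_onM; [apply: subset_trans PA _ | apply: subset_trans QB _];
  by apply/subsetP => i; rewrite !inE mem_cat => ->; rewrite ?orbT.
Qed.

(** The left factor of [v] is moved across the right factor of [u].  The
    supports [P] and [Q'] are allowed to meet. *)
Lemma factor_mul P Q P' Q' u v :
  [disjoint P & P'] -> [disjoint Q & P'] -> [disjoint Q & Q'] ->
  factor P Q u -> factor P' Q' v -> factor (P ++ P') (Q ++ Q') (u * v).
Proof.
move=> dPP dQP dQQ [A [B [-> A3 B3 PA QB]]] [A' [B' [-> A'3 B'3 PA' QB']]].
have cAA := disjoint_perm_onC dPP PA PA'.
have cBA := disjoint_perm_onC dQP QB PA'.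
have cBB := disjoint_perm_onC dQQ QB QB'.
exists (A * A'), (B * B'); split; [|  | | exact: perm_on_catM | exact: perm_on_catM].
- by rewrite !mulgA -(mulgA A B) cBA !mulgA.
- by rewrite expgMn // A3 A'3 mulg1.
- by rewrite expgMn // B3 B'3 mulg1.
Qed.

(** * Odd cycles *)

(** The inverse of a cycle runs through its points backwards, and inverting a
    product exchanges the factors: whatever order of factors is available for
    all odd cycles, the opposite order is available too. *)
Lemma factor_cyc_rev x s :
  factor (x :: rev s) (rev s) (cyc x (rev s)) -> factor s (x :: s) (cyc x s).
Proof.
move/factor_inv; rewrite cyc_inv revK.
by apply: factor_sub => i; rewrite ?inE mem_rev.
Qed.

(** By induction, along [(x y s p) = (p x y) * (p s)].  The right factor is kept
    off [x]; by [factor_cyc_rev] the cycle [(p s)] can instead be factored with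
    its left factor off [p], hence disjoint from the new factor [(p x y)]. *)
Lemma odd_cycle_factor x s :
  uniq (x :: s) -> ~~ odd (size s) -> factor (x :: s) s (cyc x s).
Proof.
have [m] := ubnP (size s); elim: m x s => // m IHm x [|y s].
  move=> _ _ _; exists 1, 1.
  by rewrite /cyc big_nil mulg1 !expg1n; split=> //; apply: perm_on1.
case/lastP: s => [|s p] // lt_m uxs.
move: lt_m; rewrite /= size_rcons /= negbK => lt_m odd_s.
(* Listed from [p], the cycle splits as a product by concatenation. *)
rewrite -[y :: rcons s p]/(rcons (y :: s) p) cyc_rot //.
rewrite -[[:: x, y & s]]/([:: x; y] ++ s) cyc_cat.
have: uniq ([:: p; x; y] ++ s).
  by rewrite -(perm_uniq (permEl (perm_rcons p [:: x, y & s]))).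
rewrite cat_uniq -disjoint_has disjoint_sym => /and3P[uT dTs us].
have fT : factor [:: p; x; y] [::] (cyc p [:: x; y]).
  exists (cyc p [:: x; y]), 1; rewrite mulg1 expg1n cyc3_expg3 //.
  by split=> //; [exact: cyc_on | exact: perm_on1].
have fs : factor s (p :: s) (cyc p s).
  apply: factor_cyc_rev; apply: IHm; rewrite ?size_rev //; first exact: ltnW.
  move: uT us dTs; rewrite /= rev_uniq mem_rev disjoint_cons.
  by move=> _ -> /andP[->].
apply: factor_sub (factor_mul dTs _ _ fT fs) => [i|i||].
- by rewrite !(mem_cat, inE, mem_rcons) -!orbA; do !case: eqP.
- by rewrite cat0s !(inE, mem_rcons) => /orP[]->; rewrite ?orbT.
- by rewrite disjoint_has.
- by rewrite disjoint_has.
Qed.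

(** * Pairs of disjoint even cycles *)

(** The two cycles are [(a s1)] followed by [(a b)], and [(d e)] followed by
    [(e s2)].  In the middle, [(a b)(d e) = (d e b) * (b d a)], where the left
    factor fixes [a] and [s1], and the right one fixes [e] and [s2]. *)
Lemma even_cycles_factor a b d e s1 s2 :
  uniq ([:: a; b; d; e] ++ s1 ++ s2) ->
  ~~ odd (size s1) -> ~~ odd (size s2) ->
  exists P Q, factor P Q (cyc a (rcons s1 b) * cyc e (d :: s2)).
Proof.
rewrite cat_uniq -disjoint_has disjoint_sym cat_uniq -disjoint_has.
rewrite !disjoint_cons !mem_cat !negb_or => /and3P[u4].
case/and5P=> /andP[as1 as2] /andP[bs1 bs2] /andP[ds1 ds2] /andP[es1 es2] _.
rewrite disjoint_sym => /and3P[us1 d12 us2] odd1 odd2.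
have [ab ad ae [bd be de]] :
    [/\ a != b, a != d, a != e & [/\ b != d, b != e & d != e]].
  by move: u4; rewrite /= !inE !negb_or; do !case: (_ == _).
have f4 : factor [:: d; e; b] [:: b; d; a] (tperm a b * tperm d e).
  exists (cyc d [:: e; b]), (cyc b [:: d; a]); split; try exact: cyc_on.
  - have c4 : commute (cyc b [:: a]) (cyc d [:: e]).
      apply: disjoint_perm_onC (cyc_on _ _) (cyc_on _ _).
      by rewrite !disjoint_cons !inE !negb_or bd be ad ae disjoint_has.
    rewrite !cyc1 in c4; rewrite (cyc_cons d e) (cyc_cons b d) !cyc1.
    by rewrite (tpermC a b) c4 (tpermC d b) -mulgA tpermKg.
  - by apply: cyc3_expg3; rewrite /= !inE negb_or de eq_sym bd eq_sym be.
  - by apply: cyc3_expg3; rewrite /= !inE negb_or bd ![_ == a]eq_sym ab ad.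
have f1 : factor (a :: s1) s1 (cyc a s1).
  by apply: odd_cycle_factor; rewrite //= as1.
have f2 : factor s2 (e :: s2) (cyc e s2).
  apply: factor_cyc_rev; apply: odd_cycle_factor; rewrite /= ?size_rev //.
  by rewrite rev_uniq mem_rev es2.
rewrite -cats1 cyc_cat cyc1 cyc_cons (tpermC e d) -mulgA [tperm a b * _]mulgA mulgA.
have d0 P : [disjoint [::] & P] by rewrite disjoint_has.
have f14 : factor ((a :: s1) ++ [:: d; e; b]) (s1 ++ [:: b; d; a])
             (cyc a s1 * (tperm a b * tperm d e)).
  apply: factor_mul f1 f4; rewrite disjoint_sym ?disjoint_cons ?d0 ?inE.
  - by rewrite !negb_or ![_ == a]eq_sym ad ae ab ds1 es1 bs1.
  - by rewrite ds1 es1 bs1.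
  - by rewrite bs1 ds1 as1.
exists (((a :: s1) ++ [:: d; e; b]) ++ s2), ((s1 ++ [:: b; d; a]) ++ e :: s2).
apply: factor_mul f14 f2; rewrite disjoint_cat ?disjoint_cons d0.
- by rewrite as2 d12 ds2 es2 bs2.
- by rewrite d12 bs2 ds2 as2.
- rewrite disjoint_sym disjoint_cons es1 disjoint_sym d12 !inE !negb_or.
  by rewrite bs2 ds2 as2 be de ae.
Qed.

(** * Cycles as given by the successor function *)

Lemma is_cycle_cyc k u :
  is_cycle k u -> exists x s, [/\ uniq (x :: s), k = (size s).+1 & u = cyc x s].
Proof.
case=> k_gt0 [[|x s] [us sz nu]]; first by rewrite -sz in k_gt0.
by exists x, s; split=> //; apply/permP => i; rewrite nu cycE.
Qed.

(** For [s] empty the cycle is the identity, whose support misses [x].  Hence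
    disjointness of supports gives disjointness of the underlying lists only for
    cycles of length at least 2. *)
Lemma cyc_support x s :
  uniq (x :: s) -> 0 < size s -> perm_support (cyc x s) =i x :: s.
Proof.
move=> us s_gt0 i; rewrite inE; case: (boolP (i \in x :: s)) => [ic | inc].
  rewrite cycE //; case: (rot_to ic) => j c rotE.
  rewrite -(next_rot j us) rotE.
  move: us (size_rot j (x :: s)); rewrite -(rot_uniq j) rotE.
  case: c {rotE} => [_ [s0] | z c]; first by rewrite -s0 in s_gt0.
  by rewrite /= inE negb_or eqxx eq_sym => /andP[/andP[]].
by rewrite (out_perm (cyc_on _ _)) ?eqxx // inE.
Qed.

Lemma disjoint_even_cycles_factor k l u v :
  is_cycle k u -> is_cycle l v -> ~~ odd k -> ~~ odd l ->
  disjoint_perms u v -> exists P Q, factor P Q (u * v).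
Proof.
move=> /is_cycle_cyc[a [s1 [us1 -> ->]]] /is_cycle_cyc[e [s2 [us2 -> ->]]] /=.
case/lastP: s1 us1 => [|s1 b] // us1; case: s2 us2 => [|d s2] // us2.
rewrite size_rcons /= !negbK => odd1 odd2 duv.
apply: even_cycles_factor => //.
have {duv}: uniq ((a :: rcons s1 b) ++ [:: e, d & s2]).
  rewrite cat_uniq us1 us2 andbT -disjoint_has disjoint_sym.
  apply/pred0P => i; move/pred0P/(_ i): duv.
  by rewrite /= !cyc_support // size_rcons.
congr (is_true _); apply: perm_uniq; apply/seq.permP => p.
rewrite /= -cats1 !count_cat /= addn0.
by rewrite -(addnA (count p s1)) (addnCA (p d)) !(addnCA (count p s1)).
Qed.

Lemma transposition_is_cycle u : is_transposition u -> is_cycle 2 u.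
Proof.
case=> x [y [xy ->]]; split=> //; exists [:: x; y].
have us : uniq [:: x; y] by rewrite /= inE xy.
by split=> // i; rewrite -cyc1 cycE.
Qed.

End CubeFactorizations.

(** * The equation (uh)^3 = h^3 *)

Lemma factor_G3 n (u : 'S_n) P Q :
  factor P Q u -> G3 u != set0 /\ exists2 h : 'S_n, h \in G3 u & h ^+ 3 = 1.
Proof.
move=> [A [B [-> A3 B3 _ _]]].
have hG : B^-1 \in G3 (A * B) by rewrite inE mulgK A3 expgVn B3 invg1.
split; first by apply/set0Pn; exists B^-1.
by exists B^-1; rewrite // expgVn B3 invg1.
Qed.

Theorem proposition3p5p5 (n : nat) (u : 'S_n) (u_even : ~~ odd_perm u)
    (u_case :
      [\/ exists c : nat, is_cycle (2 * c + 1) u,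
          exists (t v : 'S_n) (k : nat),
            [/\ is_transposition t, ~~ odd k, is_cycle k v,
                disjoint_perms t v & u = (t * v)%g]
        | exists (t v : 'S_n) (k : nat),
            [/\ is_cycle 4 t, ~~ odd k /\ 4 <= k, is_cycle k v,
                disjoint_perms t v & u = (t * v)%g]]) :
  G3 u != set0 /\ exists2 h : 'S_n, h \in G3 u & (h ^+ 3 = 1)%g.
Proof.
suff [P [Q]] : exists P Q, factor P Q u by apply: factor_G3.
case: u_case => [[c /is_cycle_cyc[x [s [us sz ->]]]] | | ].
- exists (x :: s), s; apply: odd_cycle_factor => //.
  by move: sz; rewrite addn1 => -[<-]; rewrite oddM.
- move=> [t [v [k [tt ek kv dtv ->]]]].
  exact: disjoint_even_cycles_factor (transposition_is_cycle tt) kv _ ek dtv.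
- move=> [t [v [k [t4 [ek _] kv dtv ->]]]].
  exact: disjoint_even_cycles_factor t4 kv _ ek dtv.
Qed.
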